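(* Let $\omega$ be the symmetric sum, $\omega(x,y,z) = x(y\circ z) + y(z\circ x) + z(x\circ y)$, where $u \circ v = \tfrac12(uv+vu)$. Then (the cosets of) the elements of the set $\{\, a^i (ba)^j b^k \mid 0 \le i,k \le 2,\ j \ge 0 \,\}$ form a basis of the universal associative envelope $U(A^\omega)$ as a vector space over $\mathbb{F}$.
   Context: $\mathbb{F}$ is a field of characteristic $0$. $A$ is the 2-dimensional space of $2\times 2$ matrices over $\mathbb{F}$ with zero diagonal, with basis $e_1 = \begin{bmatrix} 0&1\\0&0\end{bmatrix}$, $e_2 = \begin{bmatrix} 0&0\\1&0\end{bmatrix}$; it is closed under triple products $xyz$ of matrices. For a trilinear operation $\omega(x,y,z)$ (a fixed rational linear combination of the six products of $x,y,z$ in all orders), $A^\omega$ denotes the space $A$ with the trilinear operation $\omega$ computed using matrix multiplication. Let $\mathbb{F}\langle a,b\rangle$ be the free unital associative algebra and $\phi\colon A \to \mathbb{F}\langle a,b\rangle$ the linear map with $\phi(e_1)=a$, $\phi(e_2)=b$. The universal associative envelope is $U(A^\omega) = \mathbb{F}\langle a,b\rangle / I$, where $I$ is the two-sided ideal generated by the elements $\omega(\phi(x),\phi(y),\phi(z)) - \phi(\omega(x,y,z))$ for $x,y,z\in\{e_1,e_2\}$. The cosets of $a,b$ in $U(A^\omega)$ are again written $a,b$. *)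

(* Defs.v *)
From HB Require Import structures.
From mathcomp Require Import all_boot all_order all_algebra.
From mathcomp Require Import boolp.
From mathcomp Require Import finmap monalg.

Set Implicit Arguments.
Unset Strict Implicit.
Unset Printing Implicit Defensive.

Import GRing.Theory.

Local Open Scope ring_scope.
Local Open Scope quotient_scope.

Section Basis.
Context (F : fieldType) (V : lmodType F) (X : eqType).

Definition lin_indep (v : X -> V) : Prop :=
  forall (s : seq X) (c : X -> F),
    uniq s -> \sum_(x <- s) c x *: v x = 0 -> {in s, forall x, c x = 0}.

Definition spanning (v : X -> V) : Prop :=
  forall u : V, exists (s : seq X) (c : X -> F), u = \sum_(x <- s) c x *: v x.

Definition is_basis (v : X -> V) : Prop := lin_indep v /\ spanning v.
End Basis.

Section Ideal.
Context (R : nzRingType).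

Definition two_sided_ideal (J : R -> Prop) : Prop :=
  [/\ J 0,
      forall x y, J x -> J y -> J (x - y)
    & forall r x, J x -> J (r * x) /\ J (x * r)].

Definition ideal_gen (S : R -> Prop) (x : R) : Prop :=
  forall J, two_sided_ideal J -> (forall y, S y -> J y) -> J x.

Lemma ideal_gen_ideal (S : R -> Prop) : two_sided_ideal (ideal_gen S).
Proof.
split=> [J [] //|x y Sx Sy J HJ HS|r x Sx].
  by have [_ H _] := HJ; apply: H; [exact: Sx|exact: Sy].
by split=> J HJ HS; have [_ _ H] := HJ; have [] := H r x (Sx J HJ HS).
Qed.

Lemma ideal_gen_sub (S : R -> Prop) x : S x -> ideal_gen S x.
Proof. by move=> Sx J _; apply. Qed.
End Ideal.

HB.mixin Record isIdeal2 (R : nzRingType) (S : R -> bool) := {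
  ideal2_subproof :
    (1 \notin (S : {pred R})) /\
    (forall r x : R, x \in (S : {pred R}) ->
       (r * x \in (S : {pred R})) /\ (x * r \in (S : {pred R})))
}.

(* proper two-sided ideals; ring_quotient only builds the quotient ring for a
   commutative ring *)
#[short(type="ideal2")]
HB.structure Definition Ideal2 (R : nzRingType) :=
  {S of GRing.ZmodClosed R S & isIdeal2 R S}.

Section QuotientAlgebra.
Context (F : fieldType) (R : algType F) (I : ideal2 R).

Lemma ideal2_neq1 : 1 \notin (I : {pred R}).
Proof. exact: (@ideal2_subproof _ I).1. Qed.

Lemma ideal2M (r x : R) :
  x \in (I : {pred R}) -> (r * x \in (I : {pred R})) /\ (x * r \in (I : {pred R})).
Proof. exact: (@ideal2_subproof _ I).2. Qed.

Definition algquot : Type := {ideal_quot I}.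

HB.instance Definition _ := GRing.Zmodule.on algquot.
HB.instance Definition _ := EqQuotient.on algquot.

Definition aq_one : algquot := \pi_algquot 1.
Definition aq_mul (x y : algquot) : algquot := \pi_algquot (repr x * repr y).
Definition aq_scale (c : F) (x : algquot) : algquot := \pi_algquot (c *: repr x).

Lemma pi_aqE (x y : R) :
  \pi_algquot x = \pi_algquot y <-> x - y \in (I : {pred R}).
Proof. by rewrite Quotient.idealrBE; split=> /eqP. Qed.

Lemma repr_pi (x : R) : repr (\pi_algquot x) - x \in (I : {pred R}).
Proof. by apply/pi_aqE; rewrite reprK. Qed.

Lemma pi_aq_mul (x y : R) :
  aq_mul (\pi_algquot x) (\pi_algquot y) = \pi_algquot (x * y).
Proof.
apply/pi_aqE; set x' := repr _; set y' := repr _.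
have -> : x' * y' - x * y = x' * (y' - y) + (x' - x) * y.
  by rewrite mulrBr mulrBl addrA subrK.
by rewrite rpredD //; [have [] := ideal2M x' (repr_pi y)
                      |have [] := ideal2M y (repr_pi x)].
Qed.

Lemma pi_aq_scale (c : F) (x : R) :
  aq_scale c (\pi_algquot x) = \pi_algquot (c *: x).
Proof.
apply/pi_aqE; rewrite -scalerBr -[_ - _]mul1r scalerAl.
by have [] := ideal2M (c *: 1) (repr_pi x).
Qed.

Lemma pi_aqD (x y : R) :
  \pi_algquot (x + y) = \pi_algquot x + \pi_algquot y.
Proof. exact: (@Quotient.pi_add R I x y). Qed.

Lemma aq_mulA : associative aq_mul.
Proof.
move=> x y z; rewrite -[x]reprK -[y]reprK -[z]reprK.
move: (repr x) (repr y) (repr z) => a b c.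
by rewrite (pi_aq_mul a b) (pi_aq_mul b c) (pi_aq_mul a) (pi_aq_mul _ c) mulrA.
Qed.

Lemma aq_mul1 : left_id aq_one aq_mul.
Proof.
by move=> x; rewrite -[x]reprK /aq_one; move: (repr x) => a; rewrite pi_aq_mul mul1r.
Qed.

Lemma aq_mulr1 : right_id aq_one aq_mul.
Proof.
by move=> x; rewrite -[x]reprK /aq_one; move: (repr x) => a; rewrite pi_aq_mul mulr1.
Qed.

Lemma aq_mulDl : left_distributive aq_mul +%R.
Proof.
move=> x y z; rewrite -[x]reprK -[y]reprK -[z]reprK.
move: (repr x) (repr y) (repr z) => a b c.
by rewrite -(pi_aqD a b) (pi_aq_mul a) (pi_aq_mul b) (pi_aq_mul _ c) -pi_aqD mulrDl.
Qed.

Lemma aq_mulDr : right_distributive aq_mul +%R.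
Proof.
move=> x y z; rewrite -[x]reprK -[y]reprK -[z]reprK.
move: (repr x) (repr y) (repr z) => a b c.
by rewrite -(pi_aqD b c) (pi_aq_mul _ b) (pi_aq_mul _ c) (pi_aq_mul a) -pi_aqD mulrDr.
Qed.

Lemma aq_one_neq0 : aq_one != 0.
Proof.
apply: contra ideal2_neq1 => /eqP H.
rewrite -[1]subr0; apply/pi_aqE; rewrite -[LHS]/aq_one H.
exact: (esym (@pi_zeror R _ 0 -%R +%R {ideal_quot I})).
Qed.

HB.instance Definition _ := GRing.Zmodule_isNzRing.Build algquot
  aq_mulA aq_mul1 aq_mulr1 aq_mulDl aq_mulDr aq_one_neq0.

Lemma aq_scaleA c d x : aq_scale c (aq_scale d x) = aq_scale (c * d) x.
Proof.
rewrite -[x]reprK; move: (repr x) => a.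
by rewrite (pi_aq_scale d) (pi_aq_scale c) (pi_aq_scale (c * d)) scalerA.
Qed.

Lemma aq_scale1 : left_id 1 aq_scale.
Proof.
by move=> x; rewrite -[x]reprK; move: (repr x) => a; rewrite pi_aq_scale scale1r.
Qed.

Lemma aq_scaleDr : right_distributive aq_scale +%R.
Proof.
move=> c x y; rewrite -[x]reprK -[y]reprK; move: (repr x) (repr y) => a b.
by rewrite -(pi_aqD a b) !(pi_aq_scale c) -pi_aqD scalerDr.
Qed.

Lemma aq_scaleDl x : {morph aq_scale^~ x : c d / c + d}.
Proof.
move=> c d; rewrite /= -[x]reprK; move: (repr x) => a.
by rewrite (pi_aq_scale c) (pi_aq_scale d) (pi_aq_scale (c + d)) -pi_aqD scalerDl.
Qed.

HB.instance Definition _ := GRing.Zmodule_isLmodule.Build F algquot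
  aq_scaleA aq_scale1 aq_scaleDr aq_scaleDl.

Lemma aq_scale_mull (c : F) (x y : algquot) :
  aq_scale c (aq_mul x y) = aq_mul (aq_scale c x) y.
Proof.
rewrite -[x]reprK -[y]reprK; move: (repr x) (repr y) => a b.
by rewrite (pi_aq_mul a b) (pi_aq_scale c (a * b)) (pi_aq_scale c a) pi_aq_mul scalerAl.
Qed.

Lemma aq_scaleAl (c : F) (x y : algquot) : c *: (x * y) = (c *: x) * y.
Proof. exact: aq_scale_mull. Qed.

HB.instance Definition _ :=
  GRing.Lmodule_isLalgebra.Build F algquot aq_scaleAl.

Lemma aq_scale_mulr (c : F) (x y : algquot) :
  aq_scale c (aq_mul x y) = aq_mul x (aq_scale c y).
Proof.
rewrite -[x]reprK -[y]reprK; move: (repr x) (repr y) => a b.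
by rewrite (pi_aq_mul a b) (pi_aq_scale c (a * b)) (pi_aq_scale c b) pi_aq_mul scalerAr.
Qed.

Lemma aq_scaleAr (c : F) (x y : algquot) : c *: (x * y) = x * (c *: y).
Proof. exact: aq_scale_mulr. Qed.

HB.instance Definition _ :=
  GRing.Lalgebra_isAlgebra.Build F algquot aq_scaleAr.

Definition coset (x : R) : algquot := \pi_algquot x.

Lemma coset_is_linear : linear coset.
Proof.
move=> c x y; rewrite /coset (pi_aqD (c *: x)).
by congr (_ + _); rewrite -(pi_aq_scale c x).
Qed.

Lemma coset_is_monoid_morphism : monoid_morphism coset.
Proof.
split=> [|x y]; first by [].
exact: (esym (pi_aq_mul x y)).
Qed.

HB.instance Definition _ :=
  GRing.isLinear.Build F R algquot _ coset coset_is_linear.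
HB.instance Definition _ :=
  GRing.isMonoidMorphism.Build R algquot coset coset_is_monoid_morphism.

Lemma coset_eq0 (x : R) : coset x = 0 <-> x \in (I : {pred R}).
Proof. by rewrite -(rmorph0 coset) /coset pi_aqE subr0. Qed.
End QuotientAlgebra.

(* The operation is given uniformly in the associative algebra in which it is
   computed, since the same omega is used in matrices and in the free algebra. *)
Record trilinear_op (F : fieldType) := TrilinearOp {
  triop :> forall R : algType F, R -> R -> R -> R;
  triopP : exists c1 c2 c3 c4 c5 c6 : rat,
    forall (R : algType F) (x y z : R), triop x y z =
      ratr c1 *: (x * y * z) + ratr c2 *: (x * z * y)
    + ratr c3 *: (y * x * z) + ratr c4 *: (y * z * x)
    + ratr c5 *: (z * x * y) + ratr c6 *: (z * y * x)
}.

Section Morphism.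
Context (F : fieldType) (R S : algType F) (f : {lrmorphism R -> S}).

Lemma triop_morph (w : trilinear_op F) (x y z : R) :
  f (w R x y z) = w S (f x) (f y) (f z).
Proof.
have [c1 [c2 [c3 [c4 [c5 [c6 E]]]]]] := triopP w.
by rewrite !E !linearD !linearZ /= !rmorphM.
Qed.

Lemma ker_ideal : two_sided_ideal (fun x => f x = 0).
Proof.
split=> [|x y Hx Hy|r x Hx]; first exact: rmorph0.
  by rewrite rmorphB /= Hx Hy subrr.
by rewrite (rmorphM f r x) (rmorphM f x r) /= Hx mulr0 mul0r.
Qed.

Lemma lrmorph_comb (c d : F) (x y : R) : f (c *: x + d *: y) = c *: f x + d *: f y.
Proof. by rewrite linearD !linearZ. Qed.

Lemma triop_rel_ker (w : trilinear_op F) (p q r t : R) (x y z : S) :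
  f p = x -> f q = y -> f r = z -> f t = w S x y z -> f (w R p q r - t) = 0.
Proof. by rewrite rmorphB /= triop_morph => -> -> -> ->; rewrite subrr. Qed.
End Morphism.

Section SymmetricSum.
Context (F : fieldType).

Definition jordan (R : algType F) (u v : R) : R := 2^-1 *: (u * v + v * u).

Definition symmetric_sum_fun (R : algType F) (x y z : R) : R :=
  x * jordan y z + y * jordan z x + z * jordan x y.

Lemma symmetric_sumP : exists c1 c2 c3 c4 c5 c6 : rat,
  forall (R : algType F) (x y z : R), symmetric_sum_fun x y z =
    ratr c1 *: (x * y * z) + ratr c2 *: (x * z * y)
  + ratr c3 *: (y * x * z) + ratr c4 *: (y * z * x)
  + ratr c5 *: (z * x * y) + ratr c6 *: (z * y * x).
Proof.
exists 2^-1, 2^-1, 2^-1, 2^-1, 2^-1, 2^-1 => R x y z.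
have -> : ratr 2^-1 = 2^-1 :> F.
  rewrite /ratr.
  have -> : numq 2^-1 = 1 by [].
  have -> : denq 2^-1 = 2 by [].
  by rewrite mul1r.
rewrite /symmetric_sum_fun /jordan -!scalerAr -!scalerDr !mulrDr !mulrA.
congr (_ *: _); rewrite -!addrA; congr (_ + (_ + _)).
by rewrite addrCA; do 2 congr (_ + _).
Qed.

Definition symmetric_sum : trilinear_op F := TrilinearOp symmetric_sumP.
End SymmetricSum.

Section OffDiagonal.
Context (F : fieldType).

Definition zero_diag : {pred 'M[F]_2} := fun M => [forall i, M i i == 0].

Lemma zero_diagP (M : 'M[F]_2) :
  reflect (forall i, M i i = 0) (M \in zero_diag).
Proof. exact: 'forall_eqP. Qed.

Lemma zero_diag_closed : subsemimod_closed zero_diag.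
Proof.
split; first split.
- by apply/zero_diagP => i; rewrite mxE.
- move=> M N /zero_diagP HM /zero_diagP HN; apply/zero_diagP => i.
  by rewrite mxE HM HN addr0.
- move=> c M /zero_diagP HM; apply/zero_diagP => i.
  by rewrite mxE HM mulr0.
Qed.

HB.instance Definition _ :=
  GRing.isSubmodClosed.Build F 'M[F]_2 zero_diag zero_diag_closed.

Lemma zero_diagN (M : 'M[F]_2) : M \in zero_diag -> - M \in zero_diag.
Proof. by rewrite -scaleN1r => /rpredZ ->. Qed.

HB.instance Definition _ := GRing.isOppClosed.Build 'M[F]_2 zero_diag zero_diagN.

Record offdiag := OffDiag { offdiag_mx :> 'M[F]_2; _ : offdiag_mx \in zero_diag }.

HB.instance Definition _ := [isSub for offdiag_mx].
HB.instance Definition _ := [Choice of offdiag by <:].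
HB.instance Definition _ := [SubChoice_isSubLmodule of offdiag by <:].

Lemma zero_diagM3 (x y z : 'M[F]_2) :
  x \in zero_diag -> y \in zero_diag -> z \in zero_diag ->
  x * y * z \in zero_diag.
Proof.
move=> /zero_diagP Hx /zero_diagP Hy /zero_diagP Hz; apply/zero_diagP => i.
rewrite mxE big1 // => j _; have [->|ij] := eqVneq j i; first by rewrite Hz mulr0.
rewrite mxE big1 ?mul0r // => k _.
have [->|ki] := eqVneq k i; first by rewrite Hx mul0r.
suff -> : k = j by rewrite Hy mulr0.
by move: i j k ij ki => [[|[|?]] ?] [[|[|?]] ?] [[|[|?]] ?] // _ _; apply/val_inj.
Qed.

Lemma triop_zero_diag (w : trilinear_op F) (x y z : offdiag) :
  w _ (val x) (val y) (val z) \in zero_diag.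
Proof.
have [c1 [c2 [c3 [c4 [c5 [c6 ->]]]]]] := triopP w.
by do ![apply: rpredD]; apply: rpredZ; apply: zero_diagM3; apply: valP.
Qed.

(* A^omega *)
Definition offdiag_op (w : trilinear_op F) (x y z : offdiag) : offdiag :=
  OffDiag (triop_zero_diag w x y z).

Lemma e1_subproof : delta_mx 0 1 \in zero_diag.
Proof. by apply/zero_diagP => -[[|[|?]] ?] //; rewrite mxE. Qed.

Lemma e2_subproof : delta_mx 1 0 \in zero_diag.
Proof. by apply/zero_diagP => -[[|[|?]] ?] //; rewrite mxE. Qed.

Definition e1 : offdiag := OffDiag e1_subproof.
Definition e2 : offdiag := OffDiag e2_subproof.

Lemma offdiagE (x : offdiag) : x = val x 0 1 *: e1 + val x 1 0 *: e2.
Proof.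
have /zero_diagP Hx := valP x.
have ord2 (i : 'I_2) : i = 0 \/ i = 1.
  by case: i => [[|[|?]] ?] //; [left|right]; apply/val_inj.
apply/val_inj/matrixP => i j; rewrite /= !mxE.
have [-> | ->] := ord2 i; have [-> | ->] := ord2 j;
  by rewrite ?mulr0 ?mulr1 ?addr0 ?add0r ?Hx.
Qed.
Lemma offdiag_coord_linear (V : lmodType F) (u v : V) :
  linear (fun x : offdiag => val x 0 1 *: u + val x 1 0 *: v).
Proof.
by move=> c x y; rewrite /= !mxE scalerDr !scalerA !scalerDl addrACA.
Qed.
End OffDiagonal.

Section Envelope.
Context (F : fieldType).

(* {malg F[{fmonom I}]} is the algebra of the free monoid on I; the library
   gives it no algType structure, because its monoid need not be commutative *)
Definition free2 : Type := {malg F[{fmonom 'I_2}]}.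

HB.instance Definition _ := GRing.Lalgebra.on free2.

Lemma free2_scalerAr (c : F) (x y : free2) : c *: (x * y) = x * (c *: y).
Proof.
apply/malgP => k; rewrite mcoeffZ mcoeffMl mulr_sumr.
rewrite (mcoeffMlw k (fsubset_refl _) (msuppZ_le c y)).
apply: eq_bigr => i _; rewrite mulr_sumr; apply: eq_bigr => j _.
by rewrite mcoeffZ mulrnAr mulrCA.
Qed.

HB.instance Definition _ := GRing.Lalgebra_isAlgebra.Build F free2 free2_scalerAr.

Definition fa : free2 := << fmu (0 : 'I_2) >>.
Definition fb : free2 := << fmu (1 : 'I_2) >>.

(* offdiagE, phi_e1 and phi_e2 show that this is the linear map with
   e1 |-> a and e2 |-> b *)
Definition phi (x : offdiag F) : free2 := val x 0 1 *: fa + val x 1 0 *: fb.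

Lemma phi_is_linear : linear phi.
Proof. exact: (offdiag_coord_linear fa fb). Qed.

HB.instance Definition _ :=
  GRing.isLinear.Build F (offdiag F) free2 _ phi phi_is_linear.

Lemma phi_e1 : phi (e1 F) = fa.
Proof. by rewrite /phi /= !mxE /= scale1r scale0r addr0. Qed.

Lemma phi_e2 : phi (e2 F) = fb.
Proof. by rewrite /phi /= !mxE /= scale1r scale0r add0r. Qed.

Definition word_eval (R : algType F) (u v : R) (m : {fmonom 'I_2}) : R :=
  \prod_(i <- (m : seq 'I_2)) (if i == 0 then u else v).

Lemma word_eval_subproof (R : algType F) (u v : R) : mmorphism (word_eval u v).
Proof. by split=> [x y|]; rewrite /word_eval ?fmM ?fm1 ?big_cat ?big_nil. Qed.

HB.instance Definition _ (R : algType F) (u v : R) :=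
  isMultiplicative.Build {fmonom 'I_2} R (word_eval u v) (word_eval_subproof u v).

Definition free2_eval (R : algType F) (u v : R) : free2 -> R :=
  mmap (GRing.in_alg R) (word_eval u v).

Lemma free2_eval_linear (R : algType F) (u v : R) : linear (free2_eval u v).
Proof.
by move=> c x y; rewrite /free2_eval mmapD mmapZ /= mulr_algl.
Qed.

Lemma free2_eval_monoid_morphism (R : algType F) (u v : R) :
  monoid_morphism (free2_eval u v).
Proof.
have [|HM H1] := @commr_mmap_is_multiplicative {fmonom 'I_2} F R (GRing.in_alg R)
  (word_eval u v).
  by move=> g m m'; rewrite /GRing.comm /= mulr_algl mulr_algr.
by split.
Qed.

HB.instance Definition _ (R : algType F) (u v : R) :=
  GRing.isLinear.Build F free2 R _ (free2_eval u v) (free2_eval_linear u v).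
HB.instance Definition _ (R : algType F) (u v : R) :=
  GRing.isMonoidMorphism.Build free2 R (free2_eval u v)
    (free2_eval_monoid_morphism u v).

Lemma free2_eval_a (R : algType F) (u v : R) : free2_eval u v fa = u.
Proof.
by rewrite /free2_eval /fa mmapU /= scale1r mul1r /word_eval fmU big_seq1.
Qed.

Lemma free2_eval_b (R : algType F) (u v : R) : free2_eval u v fb = v.
Proof.
by rewrite /free2_eval /fb mmapU /= scale1r mul1r /word_eval fmU big_seq1.
Qed.

Context (w : trilinear_op F).

Definition envelope_rel (r : free2) : Prop :=
  exists x y z : offdiag F,
    [/\ x = e1 F \/ x = e2 F, y = e1 F \/ y = e2 F, z = e1 F \/ z = e2 F
      & r = w _ (phi x) (phi y) (phi z) - phi (offdiag_op w x y z)].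

Definition envelope_ideal : {pred free2} :=
  fun x => `[< ideal_gen envelope_rel x >].

Lemma envelope_idealP x : reflect (ideal_gen envelope_rel x) (x \in envelope_ideal).
Proof. exact: asboolP. Qed.

Lemma envelope_ideal_zmod_closed : zmod_closed envelope_ideal.
Proof.
have [I0 IB _] := ideal_gen_ideal envelope_rel.
by split=> [|x y /envelope_idealP Ix /envelope_idealP Iy];
  apply/envelope_idealP => //; apply: IB.
Qed.

HB.instance Definition _ :=
  GRing.isZmodClosed.Build free2 envelope_ideal envelope_ideal_zmod_closed.

Lemma envelope_idealM r x : x \in envelope_ideal ->
  r * x \in envelope_ideal /\ x * r \in envelope_ideal.
Proof.
have [_ _ IM] := ideal_gen_ideal envelope_rel.
move=> /envelope_idealP Ix; have [I1 I2] := IM r x Ix.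
by split; apply/envelope_idealP; [exact: I1|exact: I2].
Qed.

Lemma envelope_ideal1 : 1 \notin envelope_ideal.
Proof.
pose ev : {lrmorphism free2 -> 'M[F]_2} := free2_eval (val (e1 F)) (val (e2 F)).
have ev_phi x : ev (phi x) = val x.
  rewrite [LHS](lrmorph_comb ev).
  have -> : ev fa = val (e1 F) by exact: free2_eval_a.
  have -> : ev fb = val (e2 F) by exact: free2_eval_b.
  by rewrite [in RHS](offdiagE x).
apply/negP => /envelope_idealP H.
have H1 : ev 1 = 1 by exact: rmorph1.
suff : ev 1 = 0 by rewrite H1; apply/eqP; exact: oner_neq0.
apply: (H _ (ker_ideal ev)) => _ [x [y [z [_ _ _ ->]]]].
exact: (triop_rel_ker (ev_phi x) (ev_phi y) (ev_phi z)
  (ev_phi (offdiag_op w x y z))).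
Qed.

HB.instance Definition _ :=
  isIdeal2.Build free2 envelope_ideal (conj envelope_ideal1 envelope_idealM).

Definition envelope : algType F := algquot envelope_ideal.

Definition env_coset : free2 -> envelope := @coset F free2 envelope_ideal.
End Envelope.

(* Main.v *)
Require Import Defs.
From mathcomp Require Import all_boot all_order all_algebra.
From mathcomp Require Import boolp.
From mathcomp Require Import finmap monalg ring.

Set Implicit Arguments.
Unset Strict Implicit.
Unset Printing Implicit Defensive.

Import GRing.Theory.

Local Open Scope ring_scope.

(* The symmetric sum imposes a^3 = b^3 = 0, aab + aba + baa = a and
   bba + bab + abb = b. Put h = ba. The span of the a^i h^j b^k is stable under
   left multiplication by a and b, because
     h a = a (1 - h) - a^2 b  and
     b h^(j+1) = (1 - h)^(j+1) b - a h^j b^2.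
   They are independent, because for each t in F the matrices
     a = E21 + E32,  b = t E12 + (1 - t) E23
   satisfy the relations: entry (p, q) of the value of
   sum_(i,j,k) c_ijk a^i h^j b^k, once all coefficients with i < p vanish, is
   the polynomial (sum_j c_pjq t^j) b_q(t), where b_q is a fixed nonzero
   polynomial; it vanishes at every t and F is infinite. *)

(** * Finite linear combinations of a family of vectors *)

Section Span.
Context (F : fieldType) (V : lmodType F) (X : eqType) (v : X -> V).

(** The list may repeat indices, so that adding two combinations is mere concatenation. *)
Definition in_span (u : V) : Prop :=
  exists s : seq (F * X), u = \sum_(p <- s) p.1 *: v p.2.

Lemma in_span_gen x : in_span (v x).
Proof. by exists [:: (1, x)]; rewrite big_seq1 scale1r. Qed.

Lemma in_span0 : in_span 0.
Proof. by exists [::]; rewrite big_nil. Qed.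

Lemma in_spanD u w : in_span u -> in_span w -> in_span (u + w).
Proof. by case=> s -> [t ->]; exists (s ++ t); rewrite big_cat. Qed.

Lemma in_spanZ c u : in_span u -> in_span (c *: u).
Proof.
case=> s ->; exists [seq (c * p.1, p.2) | p <- s]; rewrite big_map scaler_sumr.
by apply: eq_bigr => p _; rewrite scalerA.
Qed.

Lemma in_spanB u w : in_span u -> in_span w -> in_span (u - w).
Proof. by move=> Su Sw; rewrite -scaleN1r; apply/in_spanD/in_spanZ. Qed.

Lemma in_span_sum (I : Type) (r : seq I) (f : I -> V) :
  (forall i, in_span (f i)) -> in_span (\sum_(i <- r) f i).
Proof.
by move=> Sf; elim/big_ind: _ => // [|u w]; [exact: in_span0|exact: in_spanD].
Qed.

(** Repetitions are merged: the coefficient of [x] is the sum of all scalars paired with it. *)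
Lemma in_spanW u : in_span u ->
  exists (s : seq X) (c : X -> F), u = \sum_(x <- s) c x *: v x.
Proof.
case=> s ->; exists (undup [seq p.2 | p <- s]).
exists (fun x => \sum_(p <- s | p.2 == x) p.1).
under [RHS]eq_bigr do rewrite scaler_suml big_mkcond.
rewrite exchange_big /=; apply: eq_big_seq => p ps.
rewrite (bigD1_seq p.2) ?undup_uniq ?mem_undup ?map_f //= eqxx.
by rewrite big1 ?addr0 // => x; rewrite eq_sym => /negPf ->.
Qed.
End Span.

(** * Normal forms modulo the four relations *)

Section Relations.
Context (F : fieldType) (R : algType F).

Definition sym_rels (u v : R) : Prop :=
  [/\ u * u * u = 0, v * v * v = 0,
      u * u * v + u * v * u + v * u * u = u
    & v * v * u + v * u * v + u * v * v = v].

Section Span.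
Context (u v : R) (uv : sym_rels u v).

Let h := v * u.
Let g := u * v.
Let X := ('I_3 * nat * 'I_3)%type.
Let mon (t : X) : R := u ^+ t.1.1 * h ^+ t.1.2 * v ^+ t.2.

Let u3 : u * u * u = 0. Proof. by case: uv. Qed.
Let v3 : v * v * v = 0. Proof. by case: uv. Qed.

(** The fourth relation solved for [v * v * u]; [hu] is the third one solved for [v * u * u]. *)
Let vh : v * h = (1 - h) * v - u * v * v.
Proof.
case: uv => _ _ _ E; rewrite mulrBl mul1r /h !mulrA.
by apply/eqP; rewrite eq_sym !subr_eq -{1}E addrAC.
Qed.

Let hu : h * u = u * (1 - h) - u * u * v.
Proof.
case: uv => _ _ E _; rewrite mulrBr mulr1 /h !mulrA.
by apply/eqP; rewrite eq_sym !subr_eq -{1}E addrC addrA.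
Qed.

(** By [vh] and [hu], both sides equal [u * (1 - h) * v - u * u * v * v]. *)
Let gh : g * h = h * g.
Proof.
have -> : g * h = u * (v * h) by rewrite /g mulrA.
have -> : h * g = (h * u) * v by rewrite /g !mulrA.
by rewrite vh hu mulrBr [RHS]mulrBl !mulrA.
Qed.

(** On [u * v * v], left multiplication by [1 - h] agrees with that by [g], because the cube of [v]
    is zero. As [g] commutes with [1 - h], this passes to powers, and [g ^+ j * u = u * h ^+ j]. *)
Let hj_uvv j : (1 - h) ^+ j * (u * v * v) = u * h ^+ j * v * v.
Proof.
have gu n : u * h ^+ n = g ^+ n * u.
  elim: n => [|n IH]; first by rewrite expr0 mulr1 mul1r.
  by rewrite !exprSr mulrA IH /g /h !mulrA.
have E1 : (1 - h) * (u * v * v) = g * (u * v * v).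
  have vvv0 : u * u * v * v * v = 0.
    by rewrite -2!mulrA [v * (v * v)]mulrA v3 mulr0.
  rewrite mulrBl mul1r !mulrA hu mulrBr mulr1 !mulrBl vvv0 subr0 subKr.
  by rewrite /g /h !mulrA.
rewrite gu.
have -> : g ^+ j * u * v * v = g ^+ j * (u * v * v) by rewrite !mulrA.
set w := u * v * v in E1 *.
elim: j => [|j IH]; first by rewrite !expr0.
rewrite exprSr -mulrA E1 mulrA.
have /commrX <- : GRing.comm g (1 - h).
  by apply: commrB; [exact: commr1|exact: gh].
by rewrite -mulrA IH mulrA -exprS.
Qed.

Let vhS j : v * h ^+ j.+1 = (1 - h) ^+ j.+1 * v - u * h ^+ j * v * v.
Proof.
elim: j => [|j IH]; first by rewrite !expr1 expr0 mulr1 vh.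
(* A further factor [h] kills the old correction term; only the one created by the new use of [vh]
   survives. *)
have vvh x : x * v * v * h = 0.
  rewrite /h mulrA -2!mulrA -mulrA [v * (v * _)]mulrA [_ * (v * u)]mulrA.
  by rewrite v3 mul0r mulr0.
rewrite [X in v * X]exprSr mulrA IH mulrBl vvh subr0.
by rewrite -[_ * v * h]mulrA vh mulrBr hj_uvv mulrA -exprSr.
Qed.

(** The correction term of [vhS] begins with [u], so [u * u] on its left kills it. *)
Let uuvh j : u * u * v * h ^+ j = u * u * (1 - h) ^+ j * v.
Proof.
case: j => [|j]; first by rewrite !expr0 !mulr1.
by rewrite -[_ * v * _]mulrA vhS mulrBr !mulrA u3 !mul0r subr0.
Qed.

Let S := in_span mon.

Let S_mon i j k : S (u ^+ i * h ^+ j * v ^+ k).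
Proof.
have [i3|i3] := ltnP i 3; last first.
  rewrite -(subnK i3) exprD 2!exprSr expr1 u3 !(mulr0, mul0r).
  exact: in_span0.
have [k3|k3] := ltnP k 3; last first.
  by rewrite -(subnK k3) exprD 2!exprSr expr1 v3 !mulr0; apply: in_span0.
exact: (in_span_gen mon (Ordinal i3, j, Ordinal k3)).
Qed.

Let S_mon1 i n j k : S (u ^+ i * (1 - h) ^+ n * h ^+ j * v ^+ k).
Proof.
elim: n j => [|n IH] j; first by rewrite mulr1.
rewrite exprSr mulrA mulrBr mulr1 !mulrBl -[_ * h * _]mulrA -exprS.
by apply: in_spanB; apply: IH.
Qed.

(** Left multiplication is enough for spanning, since words grow from 1 by adding letters on the
    left. *)
Lemma in_span_mull r : S r -> S (u * r) /\ S (v * r).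
Proof.
suff H t : S (u * mon t) /\ S (v * mon t).
  case=> s ->; rewrite !mulr_sumr; split; apply: in_span_sum => p;
  by rewrite -scalerAr; apply: in_spanZ; case: (H p.2).
case: t => [[i j] k]; rewrite /mon /=; split; first by rewrite !mulrA -exprS.
(* For [i = 0], [vhS] moves [v] to the right; for [i = 1], [v * u] is absorbed into the power of
   [h]; for [i = 2], [v * u ^+ 2 = h * u] is rewritten by [hu]. *)
case: i => [[|[|[|//]]] ?] /=.
- rewrite mul1r mulrA; case: j => [|j].
    by have := S_mon 0 0 k.+1; rewrite !expr0 !mul1r mulr1 -exprS.
  rewrite vhS mulrBl -!mulrA -!exprS.
  apply: in_spanB; last by have := S_mon 1 j k.+2; rewrite !mulrA.
  by have := S_mon1 0 j.+1 0 k.+1; rewrite mul1r mulr1.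
- by rewrite expr1 !mulrA -exprS; have := S_mon 0 j.+1 k; rewrite mul1r.
- have -> : v * (u ^+ 2 * h ^+ j * v ^+ k) = h * u * h ^+ j * v ^+ k.
    by rewrite expr2 !mulrA.
  rewrite hu !mulrBl uuvh -[_ * v * _]mulrA -exprS -expr2.
  apply: in_spanB; first by have := S_mon1 1 1 j k.
  by have := S_mon1 2 j 0 k.+1; rewrite mulr1.
Qed.
End Span.
End Relations.

(** * Reduction of the symmetric sum to the four relations *)

Section SymmetricSum.
Context (F : fieldType) (charF0 : [pchar F] =i pred0) (R : algType F).
Local Notation ss := (@symmetric_sum_fun F R).

Lemma symmetric_sum_rot (x y z : R) : ss x y z = ss y z x.
Proof. by rewrite /symmetric_sum_fun -addrA addrC. Qed.

Let two_neq0 : 2 != 0 :> F.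
Proof. by have /pcharf0P -> := charF0. Qed.

(** Each of the three words arises twice, which cancels the factor 1/2. *)
Lemma symmetric_sum_xxy (x y : R) :
  ss x x y = x * x * y + x * y * x + y * x * x.
Proof.
rewrite /symmetric_sum_fun /jordan -!scalerAr -!scalerDr !mulrDr !mulrA.
set a := x * x * y; set b := x * y * x; set c := y * x * x.
suff -> : a + b + (b + a) + (c + c) = 2 *: (a + b + c).
  by rewrite scalerA mulVf ?scale1r.
by rewrite scaler_nat mulr2n [b + a]addrC addrACA.
Qed.

Lemma symmetric_sum_xxx (x : R) : ss x x x = 3 *: (x * x * x).
Proof. by rewrite symmetric_sum_xxy scaler_nat !mulrS mulr0n addr0 addrA. Qed.

Section Table.
Context (u v : R).

Definition gen2 (i : bool) : R := if i then v else u.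

(** The triple products of the basis of [A^omega]: zero on a constant triple, otherwise the letter
    occurring twice. When [i] and [j] differ, that letter is the one of index [k], as [k] equals one
    of them. *)
Definition symmetric_table (i j k : bool) : R :=
  if i == j then if j == k then 0 else gen2 i else gen2 k.

(** Cyclic invariance reduces the eight triples to the shapes [x x x] and [x x y]; the cubes carry a
    factor 3, invertible in characteristic 0. *)
Lemma sym_relsP : sym_rels u v <->
  forall i j k, ss (gen2 i) (gen2 j) (gen2 k) = symmetric_table i j k.
Proof.
have three_neq0 : 3 != 0 :> F by have /pcharf0P -> := charF0.
split=> [[u3 v3 uuv vvu] i j k|H].
  have Euuv : ss u u v = u by rewrite symmetric_sum_xxy.
  have Evvu : ss v v u = v by rewrite symmetric_sum_xxy.
  case: i j k => [] [] []; rewrite /symmetric_table /gen2 /=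
    ?symmetric_sum_xxx ?u3 ?v3 ?scaler0 //.
  - by rewrite -symmetric_sum_rot.
  - by rewrite symmetric_sum_rot.
  - by rewrite symmetric_sum_rot.
  - by rewrite -symmetric_sum_rot.
split.
- have := H false false false; rewrite symmetric_sum_xxx => /eqP.
  by rewrite scaler_eq0 (negPf three_neq0) => /eqP.
- have := H true true true; rewrite symmetric_sum_xxx => /eqP.
  by rewrite scaler_eq0 (negPf three_neq0) => /eqP.
- by have := H false false true; rewrite symmetric_sum_xxy.
- by have := H true true false; rewrite symmetric_sum_xxy.
Qed.
End Table.
End SymmetricSum.

(** * The defining ideal of the envelope, evaluation and induction on the free algebra *)

Lemma malgU_scale (K : choiceType) (R : nzRingType) (c : R) (k : K) :
  << c *g k >> = c *: << k >> :> {malg R[K]}.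
Proof. by apply/malgP => l; rewrite mcoeffZ !mcoeffU mulrnAr mulr1. Qed.

Section Envelope.
Context (F : fieldType) (charF0 : [pchar F] =i pred0).
Local Notation w := (symmetric_sum F).

(** Through [sym_relsP] this yields all triple products of [e1] and [e2]. *)
Lemma offdiag_rels : sym_rels (val (e1 F)) (val (e2 F)).
Proof.
by split; rewrite /= -!mulmxE !mul_delta_mx_cond /=
  ?mulr0n ?mulr1n ?mul0mx ?add0r ?addr0.
Qed.

Lemma symmetric_envelope_relP (r : free2 F) : envelope_rel w r <->
  exists i j k, r = w _ (gen2 (fa F) (fb F) i) (gen2 (fa F) (fb F) j)
    (gen2 (fa F) (fb F) k) - symmetric_table (fa F) (fb F) i j k.
Proof.
have /(sym_relsP charF0) E12_table := offdiag_rels.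
pose e (i : bool) := if i then e2 F else e1 F.
have phi_e i : phi (e i) = gen2 (fa F) (fb F) i.
  by case: i; rewrite /e ?phi_e1 ?phi_e2.
have phi_op i j k :
    phi (offdiag_op w (e i) (e j) (e k)) = symmetric_table (fa F) (fb F) i j k.
  have -> : offdiag_op w (e i) (e j) (e k) =
      if i == j then if j == k then 0 else e i else e k.
    apply/val_inj; have val_e l : val (e l) = gen2 (val (e1 F)) (val (e2 F)) l.
      by case: l.
    rewrite /= -[LHS]/(symmetric_sum_fun (val (e i)) (val (e j)) (val (e k))).
    rewrite !val_e E12_table /symmetric_table.
    by case: (i == j); [case: (j == k)|]; rewrite -?val_e.
  rewrite /symmetric_table; case: (i == j) => //; case: (j == k) => //.
  exact: linear0.
split=> [[x [y [z [Hx Hy Hz ->]]]]|[i [j [k ->]]]]; last first.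
  exists (e i), (e j), (e k); rewrite !phi_e phi_op.
  by split=> //; rewrite /e; (case: ifP => _; [right|left]).
have ex_e t : t = e1 F \/ t = e2 F -> exists i, t = e i.
  by case=> ->; [exists false|exists true].
have [i ->] := ex_e _ Hx; have [j ->] := ex_e _ Hy; have [k ->] := ex_e _ Hz.
by exists i, j, k; rewrite !phi_e phi_op.
Qed.

Lemma env_coset_rels :
  sym_rels (env_coset w (fa F)) (env_coset w (fb F)).
Proof.
apply/(sym_relsP charF0) => i j k.
have gen_coset l : gen2 (env_coset w (fa F)) (env_coset w (fb F)) l =
    env_coset w (gen2 (fa F) (fb F) l) by case: l.
rewrite !gen_coset.
have -> : symmetric_table (env_coset w (fa F)) (env_coset w (fb F)) i j k =
    env_coset w (symmetric_table (fa F) (fb F) i j k).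
  rewrite /symmetric_table !gen_coset.
  case: (i == j) => //; case: (j == k) => //.
  by rewrite /env_coset rmorph0.
apply/eqP; rewrite -subr_eq0; apply/eqP.
rewrite -[symmetric_sum_fun _ _ _]/(w _ _ _ _) -triop_morph -rmorphB.
apply/coset_eq0/envelope_idealP; apply: ideal_gen_sub.
apply/symmetric_envelope_relP.
by exists i, j, k.
Qed.

(** The kernel of the evaluation is a two-sided ideal containing the defining relations, so the
    evaluation factors through the envelope. *)
Lemma free2_eval_ideal (R : algType F) (u v : R) (x : free2 F) :
  sym_rels u v -> env_coset w x = 0 -> free2_eval u v x = 0.
Proof.
move=> /(sym_relsP charF0) uv /coset_eq0/envelope_idealP Ix.
pose ev : {lrmorphism free2 F -> R} := free2_eval u v.
apply: (Ix _ (ker_ideal ev)) => _ /symmetric_envelope_relP[i [j [k ->]]].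
have ev_gen l : ev (gen2 (fa F) (fb F) l) = gen2 u v l.
  by case: l; [exact: free2_eval_b|exact: free2_eval_a].
apply: (triop_rel_ker (ev_gen i) (ev_gen j) (ev_gen k)).
rewrite [RHS]uv /symmetric_table; case: (i == j) => //; case: (j == k) => //.
exact: rmorph0.
Qed.

Lemma free2_ind (P : free2 F -> Prop) :
  P 1 -> (forall x, P x -> P (fa F * x) /\ P (fb F * x)) ->
  (forall x y, P x -> P y -> P (x + y)) -> (forall c x, P x -> P (c *: x)) ->
  forall x, P x.
Proof.
move=> P1 Pgen PD PZ x; rewrite [x]monalgE.
have P0 : P 0 by rewrite -(scale0r 1); apply: PZ.
elim/big_ind: _ => // m _; set c := x@_m.
rewrite malgU_scale.
apply: PZ; case: m c => s _; elim: s => [|i s IH].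
  have <- : 1 = << FMonom [::] >> :> free2 F; last by [].
  by congr (<< _ >>); rewrite -fmoneE.
have -> : << FMonom (i :: s) >> =
    (if i == 0 then fa F else fb F) * (<< FMonom s >> : free2 F).
  have -> : (if i == 0 then fa F else fb F) = << fmu i >>.
    by case: i => [[|[|//]] lt_i] /=; congr << fmu _ >>; apply/val_inj.
  rewrite [RHS]malgM_def fgmulUU mulr1; congr << _ >>.
  by apply/eqP; rewrite fmP fmM fmuE.
have [Pa Pb] := Pgen _ IH.
by case: (i == 0); [exact Pa|exact Pb].
Qed.
End Envelope.

(** In characteristic 0 the naturals below [size p] have distinct images in [F], which are more
    roots than a nonzero [p] can have. *)
Lemma poly_eq0_char0 (F : fieldType) (charF0 : [pchar F] =i pred0)
  (p : {poly F}) : (forall t, p.[t] = 0) -> p = 0.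
Proof.
move=> p0; pose rs := [seq n%:R : F | n <- iota 0 (size p)].
apply: (@roots_geq_poly_eq0 _ p rs); last by rewrite size_map size_iota.
  by apply/allP => t _; apply/eqP.
rewrite map_inj_uniq ?iota_uniq // => m n.
wlog le_mn : m n / (m <= n)%N => [W|/eqP].
  by have [/W|/ltnW /W H /esym/H] := leqP m n.
rewrite eq_sym -subr_eq0 -natrB // ((pcharf0P _).1 charF0) subn_eq0 => le_nm.
by apply/eqP; rewrite eqn_leq le_mn.
Qed.

(** * A one-parameter family of three-dimensional representations *)

Section Representation.
Context (F : fieldType).

Definition rep_a : 'M[F]_3 := \matrix_(i, j) (i == j.+1 :> nat)%:R.

Definition rep_b (t : F) : 'M[F]_3 :=
  \matrix_(i, j) if j == i.+1 :> nat then (if i == 0 then t else 1 - t) else 0.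

Lemma rep_rels t : sym_rels rep_a (rep_b t).
Proof.
have mulE (A B : 'M[F]_3) p q :
    (A * B) p q = A p 0 * B 0 q + A p 1 * B 1 q + A p ord_max * B ord_max q.
  rewrite mxE !big_ord_recl big_ord0 addr0 addrA.
  by congr (_ + A p _ * B _ q + A p _ * B _ q); apply/val_inj.
have aE p q : rep_a p q = (p == q.+1 :> nat)%:R by rewrite mxE.
have bE p q : rep_b t p q =
  if q == p.+1 :> nat then (if p == 0 then t else 1 - t) else 0 by rewrite mxE.
by split; apply/matrixP => -[[|[|[|//]]] ?] [[|[|[|//]]] ?];
  rewrite ?[RHS]mxE ?[(_ + _ : 'M_3) _ _]mxE ?mulE ?aE ?bE /=; ring.
Qed.

(** The diagonal of [ba]; its first entry makes the j-th power of [ba] contribute [t ^+ j] in row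
    0. *)
Let d (t : F) : 'rV[F]_3 := \row_j [:: t; 1 - t; 0]`_j.

Let rep_ba t : rep_b t * rep_a = diag_mx (d t).
Proof.
by apply/matrixP => -[[|[|[|//]]] ?] [[|[|[|//]]] ?];
  rewrite /rep_a /rep_b !(mxE, big_ord_recl, big_ord0) /=; ring.
Qed.

Let rep_baX t j : (rep_b t * rep_a) ^+ j = diag_mx (\row_m d t 0 m ^+ j).
Proof.
rewrite rep_ba; elim: j => [|j IH].
  (* The zero diagonal entry causes no harm at exponent 0, because [0 ^+ 0 = 1]. *)
  by apply/matrixP => p q; rewrite expr0 !mxE.
rewrite exprS IH [LHS]mulmx_diag; congr diag_mx.
by apply/rowP => m; rewrite !mxE exprS.
Qed.

Let rep_aX (i p m : 'I_3) : (rep_a ^+ i) p m = (p == m + i :> nat)%N%:R.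
Proof.
case: i p m => [[|[|[|//]]] ?] [[|[|[|//]]] ?] [[|[|[|//]]] ?];
  by rewrite /= ?expr0 ?expr1 ?expr2 !(mxE, big_ord_recl, big_ord0) /=; ring.
Qed.

(* the entry in row 0, column k, of [rep_b t ^+ k], as a polynomial in t *)
Definition rep_coef (k : nat) : {poly F} := [:: 1; 'X; 'X * (1 - 'X)]`_k.

Lemma rep_coef_neq0 (k : 'I_3) : rep_coef k != 0.
Proof.
case: k => [[|[|[|//]]] ?]; rewrite /rep_coef /= ?oner_neq0 ?polyX_eq0 //.
rewrite mulf_neq0 ?polyX_eq0 // subr_eq0.
apply/eqP => /(congr1 (size : {poly F} -> nat)).
by rewrite size_poly1 size_polyX.
Qed.

Let rep_bX t (k q : 'I_3) :
  (rep_b t ^+ k) 0 q = (k == q)%:R * (rep_coef k).[t].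
Proof.
case: k q => [[|[|[|//]]] ?] [[|[|[|//]]] ?];
  rewrite /rep_coef /= ?expr0 ?expr1 ?expr2 ?hornerE;
  by rewrite !(mxE, big_ord_recl, big_ord0) /=; ring.
Qed.

(** Entry [(p, m)] of [rep_a ^+ i] is nonzero only if [p = m + i]; under [p <= i] this forces
    [m = 0] and [p = i], leaving row 0 of the other two factors. *)
Lemma rep_monE t (i k p q : 'I_3) (j : nat) : (p <= i)%N ->
  (rep_a ^+ i * (rep_b t * rep_a) ^+ j * rep_b t ^+ k) p q =
  ((i == p) && (k == q))%:R * (t ^+ j * (rep_coef k).[t]).
Proof.
move=> le_pi; rewrite rep_baX [_ * diag_mx _]mul_mx_diag mxE (bigD1 0) //=.
rewrite !mxE /= rep_aX rep_bX add0n big1 ?addr0 => [|m m0].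
  rewrite [p == i :> nat]eq_sym -[(i == p :> nat)]/(i == p).
  by case: (i == p); case: (k == q); rewrite /= ?(mul0r, mulr0, mul1r).
rewrite !mxE rep_aX; case: eqP => [pE|]; last by rewrite !mul0r.
have : (0 < m)%N by rewrite lt0n.
move: le_pi; rewrite pE; case: (nat_of_ord m) => // n.
by rewrite addSn ltnNge leq_addl.
Qed.

Lemma rep_lin_indep (charF0 : [pchar F] =i pred0)
    (s : seq ('I_3 * nat * 'I_3)) (c : 'I_3 * nat * 'I_3 -> F) : uniq s ->
  (forall t, \sum_(x <- s) c x *: (rep_a ^+ x.1.1 *
     (rep_b t * rep_a) ^+ x.1.2 * rep_b t ^+ x.2) = 0) ->
  {in s, forall x, c x = 0}.
Proof.
move=> uniq_s rep0.
suff H n (x : 'I_3 * nat * 'I_3) : (x.1.1 < n)%N -> x \in s -> c x = 0.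
  by move=> x; apply: (H x.1.1.+1).
elim: n x => // n IH [[p j] q] /=; rewrite ltnS leq_eqVlt.
case/orP => [/eqP pn xs|lt_pn]; last exact: IH.
(* [P] gathers the terms between the powers [p] of [a] and [q] of [b]; as [s] has no repetitions,
   its coefficient at degree [j] is [c (p, j, q)]. *)
pose P := \sum_(x <- s | (x.1.1 == p) && (x.2 == q)) c x *: 'X^(x.1.2).
have P0 : P = 0.
  have /eqP : P * rep_coef q = 0.
    apply: (poly_eq0_char0 charF0) => t.
    (* In entry [(p, q)], terms with a smaller power of [a] vanish by induction, and [rep_monE]
       keeps among the others exactly those gathered in [P]. *)
    have /matrixP/(_ p q) := rep0 t; rewrite summxE mxE => <-.
    rewrite hornerM horner_sum mulr_suml big_mkcond; apply: eq_big_seq => x x_s.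
    rewrite mxE; have [lt_xp|le_px] := ltnP x.1.1 p.
      rewrite (IH x) ?mul0r -?pn //; case: ifP => // _.
      by rewrite scale0r horner0 mul0r.
    rewrite rep_monE //; case: andP => [[_ /eqP ->]|_]; last first.
      by rewrite mul0r mulr0.
    by rewrite mul1r hornerZ hornerXn mulrA.
  by rewrite mulf_eq0 (negPf (rep_coef_neq0 q)) orbF => /eqP.
have : P`_j = 0 by rewrite P0 coef0.
rewrite coef_sum big_mkcond (bigD1_seq (p, j, q)) //= !eqxx coefZ coefXn eqxx.
rewrite mulr1 big1 ?addr0 // => -[[i l] k] /=.
case: andP => // -[/eqP-> /eqP->].
rewrite coefZ coefXn !xpair_eqE !eqxx andbT /= eq_sym => /negPf ->.
by rewrite mulr0.
Qed.
End Representation.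

(** * The basis of the quotient *)

Lemma linear_comb (F : fieldType) (U V : lmodType F) (f : {linear U -> V})
    (X : Type) (s : seq X) (c : X -> F) (v : X -> U) :
  f (\sum_(x <- s) c x *: v x) = \sum_(x <- s) c x *: f (v x).
Proof. by rewrite linear_sum; apply: eq_bigr => x _; rewrite linearZ. Qed.

Section Quotient.
Context (F : fieldType) (charF0 : [pchar F] =i pred0).
Context (U : algType F) (f : {lrmorphism free2 F -> U}).
Context (f_surj : forall y, exists x, y = f x).
Context (f_rels : sym_rels (f (fa F)) (f (fb F))).
Context (f_ker : forall (R : algType F) (u v : R) (x : free2 F),
  sym_rels u v -> f x = 0 -> free2_eval u v x = 0).

Let word (t : 'I_3 * nat * 'I_3) : free2 F :=
  fa F ^+ t.1.1 * (fb F * fa F) ^+ t.1.2 * fb F ^+ t.2.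

(** By [f_ker], a combination that vanishes in [U] also vanishes at the matrices for every [t],
    which gives independence; spanning is an induction on words. *)
Lemma quotient_basis : is_basis (fun t : 'I_3 * nat * 'I_3 =>
  let: (i, j, k) := t in f (fa F ^+ i * (fb F * fa F) ^+ j * fb F ^+ k)).
Proof.
have wordE (S : algType F) (h : {lrmorphism free2 F -> S}) t : h (word t) =
    h (fa F) ^+ t.1.1 * (h (fb F) * h (fa F)) ^+ t.1.2 * h (fb F) ^+ t.2.
  rewrite /word (rmorphM h (_ * _)) (rmorphM h (_ ^+ _)).
  by rewrite !(rmorphXn h) (rmorphM h (fb F)).
have -> : (fun t : 'I_3 * nat * 'I_3 =>
    let: (i, j, k) := t in f (fa F ^+ i * (fb F * fa F) ^+ j * fb F ^+ k)) =
    f \o word by apply/funext => -[[i j] k].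
split=> [s c uniq_s sum0|y].
  apply: (rep_lin_indep charF0 uniq_s) => t.
  pose ev : {lrmorphism free2 F -> 'M[F]_3} := free2_eval (rep_a F) (rep_b t).
  have ev_a : ev (fa F) = rep_a F := free2_eval_a _ _.
  have ev_b : ev (fb F) = rep_b t := free2_eval_b _ _.
  transitivity (ev (\sum_(x <- s) c x *: word x)).
    rewrite linear_comb; apply: eq_bigr => x _.
    by have := wordE _ ev x; rewrite ev_a ev_b => <-.
  by apply: f_ker; [exact: rep_rels|rewrite linear_comb].
apply: in_spanW; have [x ->] := f_surj y.
elim/free2_ind: x => [|x IH|x z Sx Sz|c x Sx].
- have -> : f 1 = (f \o word) (ord0, 0%N, ord0).
    by rewrite /word /= !expr0 !mulr1.
  exact: in_span_gen.
- have fwE : f \o word = fun t => f (fa F) ^+ t.1.1 *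
      (f (fb F) * f (fa F)) ^+ t.1.2 * f (fb F) ^+ t.2.
    by apply/funext => t; apply: wordE.
  have := in_span_mull f_rels (r := f x); rewrite -fwE => /(_ IH) [Sa Sb].
  by split; rewrite (rmorphM f); [exact: Sa|exact: Sb].
- by rewrite rmorphD; apply: in_spanD.
- by rewrite linearZ; apply: in_spanZ.
Qed.
End Quotient.

Theorem lemma4p4 (F : fieldType) (charF0 : [pchar F] =i pred0) :
  is_basis (V := envelope (symmetric_sum F))
    (fun t : 'I_3 * nat * 'I_3 =>
       let: (i, j, k) := t in
       env_coset (symmetric_sum F)
         (fa F ^+ i * (fb F * fa F) ^+ j * fb F ^+ k)).
Proof.
apply: (quotient_basis charF0
  (f := @coset F _ (envelope_ideal (symmetric_sum F)))).
- by move=> y; exists (repr y); rewrite -[LHS]reprK.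
- exact: env_coset_rels.
- by move=> R u v x; apply: free2_eval_ideal.
Qed.
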